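(* Let $d=2$, let $n_1,n_2$ be positive integers and $\Omega\subseteq\mathcal{G}=[n_1]\times[n_2]$. Then the following are equivalent: $\Omega$ satisfies A-propagation; $\Omega$ satisfies SR-propagation; $\Omega$ satisfies S-propagation; $\Omega$ satisfies GS-propagation; $\Omega$ satisfies unique recovery. Moreover, $\Omega$ satisfies unique recovery if and only if the bipartite graph with vertex set $\{u_1,\dots,u_{n_1}\}\cup\{v_1,\dots,v_{n_2}\}$, in which $u_i$ and $v_j$ are adjacent if and only if $(i,j)\in\Omega$, is connected.
   Context: Definitions (stated for general order $d$; here $d=2$). $[m]=\{1,\dots,m\}$; $n=n_1+\dots+n_d$; $\mathcal{G}=[n_1]\times\dots\times[n_d]$. For $\alpha=(j_1,\dots,j_d)\in\mathcal{G}$, $v_\alpha\in\mathbb{F}_2^n$ is the concatenation of the indicator vectors $e^{(n_1)}_{j_1},\dots,e^{(n_d)}_{j_d}$, where $e^{(m)}_j\in\mathbb{F}_2^m$ has a $1$ in position $j$ and $0$ elsewhere. Unique recovery: for every $\hat T\in\mathbb{R}^\Omega$ with all entries nonzero, there is at most one rank-one tensor $T\in\mathbb{R}^{n_1\times\dots\times n_d}$ with $T_\alpha=\hat T_\alpha$ for all $\alpha\in\Omega$. (Rank one: $T$ is nonzero and $T_{i_1,\dots,i_d}=\prod_k u^{(k)}_{i_k}$ for some vectors $u^{(k)}\in\mathbb{R}^{n_k}$.) Generalized square (GS): a set $\{\alpha_1,\alpha_2,\alpha_3,\alpha_4\}$ of four tuples in $\mathcal{G}$ with $v_{\alpha_1}+v_{\alpha_2}+v_{\alpha_3}+v_{\alpha_4}=0$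 in $\mathbb{F}_2^n$. Square: $\{\alpha_1,\alpha_2;\alpha_3,\alpha_4\}$ is a square if $\alpha_1,\dots,\alpha_4\in\mathcal{G}$ are distinct and for every $k\in[d]$, $\max\{(\alpha_1)_k,(\alpha_2)_k\}=\max\{(\alpha_3)_k,(\alpha_4)_k\}$ and $\min\{(\alpha_1)_k,(\alpha_2)_k\}=\min\{(\alpha_3)_k,(\alpha_4)_k\}$. GS-propagation: let $\mathcal{P}_{GS}(\Omega)$ be the smallest set containing $\Omega$ such that if $\{\alpha_1,\alpha_2,\alpha_3,\beta\}$ is a generalized square with $\alpha_1,\alpha_2,\alpha_3\in\mathcal{P}_{GS}(\Omega)$, then $\beta\in\mathcal{P}_{GS}(\Omega)$. $\Omega$ satisfies GS-propagation if $\mathcal{P}_{GS}(\Omega)=\mathcal{G}$. S-propagation: let $\mathcal{P}_{S}(\Omega)$ be the smallest set containing $\Omega$ such that if $\{\alpha_1,\alpha_2;\alpha_3,\beta\}$ is a square with $\alpha_1,\alpha_2,\alpha_3\in\mathcal{P}_S(\Omega)$, then $\beta\in\mathcal{P}_S(\Omega)$. $\Omega$ satisfies S-propagation if $\mathcal{P}_S(\Omega)=\mathcal{G}$. SR-propagation: let $\mathcal{P}_{SR}(\Omega)$ be the smallest set containing $\Omega$ such that if $\{\alpha_1,\beta;\alpha_2,\gamma\}$ is a square with $\alpha_1,\alpha_2\in\Omega$ and $\beta\in\mathcal{P}_{SR}(\Omega)$, then $\gamma\in\mathcal{P}_{SR}(\Omega)$. $\Omega$ satisfies SR-propagation if $\mathcal{P}_{SR}(\Omega)=\mathcal{G}$.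 A-propagation: a sequence $\alpha_1,\dots,\alpha_p\in\mathcal{G}$ is strongly connected if for each $2\le k\le p$ there is $1\le i\le k-1$ such that $\alpha_k$ and $\alpha_i$ have $d-1$ indices in common (agree in $d-1$ coordinates). $\Omega$ satisfies A-propagation if there is a strongly connected sequence $\alpha_1,\dots,\alpha_p\in\Omega$ with $\bigcup_{k=1}^p\{(\alpha_k)_i\}=[n_i]$ for every $i\in[d]$. *)

(* Defs.v *)
From mathcomp Require Import all_boot all_order all_algebra.
From mathcomp Require Import reals.

Set Implicit Arguments.
Unset Strict Implicit.
Unset Printing Implicit Defensive.

Import GRing.Theory Num.Theory.

(* Order d = 2.  The index set [m] = {1, ..., m} is rendered by 'I_m, i.e.,
   {0, ..., m-1}; the shift is increasing, so max and min are unaffected. *)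
Definition grid (n1 n2 : nat) : finType := ('I_n1 * 'I_n2)%type.

Definition indicator (n1 n2 : nat) (a : grid n1 n2) : 'rV['F_2]_(n1 + n2) :=
  row_mx (delta_mx 0%R a.1) (delta_mx 0%R a.2).

(* A "set of four tuples" has four distinct elements.  Allowing repetitions
   would not change the propagation closure: if two of the four tuples are
   equal, then the vanishing sum forces the other two to be equal. *)
Definition generalized_square (n1 n2 : nat) (a1 a2 a3 a4 : grid n1 n2) : Prop :=
  uniq [:: a1; a2; a3; a4] /\
  (indicator a1 + indicator a2 + indicator a3 + indicator a4 = 0)%R.

(* [square a1 a2 a3 a4] stands for {a1, a2; a3, a4}: the pairs {a1, a2} and
   {a3, a4} play distinct roles (they are the two diagonals). *)
Definition square (n1 n2 : nat) (a1 a2 a3 a4 : grid n1 n2) : Prop :=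
  [/\ uniq [:: a1; a2; a3; a4],
      maxn a1.1 a2.1 = maxn a3.1 a4.1,
      minn a1.1 a2.1 = minn a3.1 a4.1,
      maxn a1.2 a2.2 = maxn a3.2 a4.2
    & minn a1.2 a2.2 = minn a3.2 a4.2].

Inductive GS_closure (n1 n2 : nat) (Omega : {set grid n1 n2}) :
    grid n1 n2 -> Prop :=
  | GS_base a : a \in Omega -> GS_closure Omega a
  | GS_step a1 a2 a3 b :
      GS_closure Omega a1 -> GS_closure Omega a2 -> GS_closure Omega a3 ->
      generalized_square a1 a2 a3 b -> GS_closure Omega b.

Definition GS_propagation (n1 n2 : nat) (Omega : {set grid n1 n2}) : Prop :=
  forall a : grid n1 n2, GS_closure Omega a.

Inductive S_closure (n1 n2 : nat) (Omega : {set grid n1 n2}) :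
    grid n1 n2 -> Prop :=
  | S_base a : a \in Omega -> S_closure Omega a
  | S_step a1 a2 a3 b :
      S_closure Omega a1 -> S_closure Omega a2 -> S_closure Omega a3 ->
      square a1 a2 a3 b -> S_closure Omega b.

Definition S_propagation (n1 n2 : nat) (Omega : {set grid n1 n2}) : Prop :=
  forall a : grid n1 n2, S_closure Omega a.

Inductive SR_closure (n1 n2 : nat) (Omega : {set grid n1 n2}) :
    grid n1 n2 -> Prop :=
  | SR_base a : a \in Omega -> SR_closure Omega a
  | SR_step a1 a2 b c :
      a1 \in Omega -> a2 \in Omega -> SR_closure Omega b ->
      square a1 b a2 c -> SR_closure Omega c.

Definition SR_propagation (n1 n2 : nat) (Omega : {set grid n1 n2}) : Prop :=
  forall a : grid n1 n2, SR_closure Omega a.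

(* Agreement in (at least) d - 1 = 1 coordinate.  Repeated terms in a strongly
   connected sequence are therefore allowed; deleting them is harmless. *)
Definition shares_index (n1 n2 : nat) (a b : grid n1 n2) : Prop :=
  a.1 = b.1 \/ a.2 = b.2.

Definition strongly_connected (n1 n2 p : nat) (s : 'I_p -> grid n1 n2) : Prop :=
  forall k : 'I_p, 0 < k ->
    exists i : 'I_p, i < k /\ shares_index (s k) (s i).

Definition A_propagation (n1 n2 : nat) (Omega : {set grid n1 n2}) : Prop :=
  exists (p : nat) (s : 'I_p -> grid n1 n2),
    [/\ forall k, s k \in Omega,
        strongly_connected s,
        \bigcup_(k < p) [set (s k).1] = [set: 'I_n1]
      & \bigcup_(k < p) [set (s k).2] = [set: 'I_n2]].

Definition rank_one (R : realType) (n1 n2 : nat) (T : 'M[R]_(n1, n2)) : Prop :=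
  T <> 0%R /\
  exists (u : 'rV[R]_n1) (v : 'rV[R]_n2),
    forall i j, T i j = (u 0 i * v 0 j)%R.

Definition completes (R : realType) (n1 n2 : nat) (Omega : {set grid n1 n2})
    (That : {a : grid n1 n2 | a \in Omega} -> R) (T : 'M[R]_(n1, n2)) : Prop :=
  forall a : {a : grid n1 n2 | a \in Omega}, T (val a).1 (val a).2 = That a.

Definition unique_recovery (R : realType) (n1 n2 : nat)
    (Omega : {set grid n1 n2}) : Prop :=
  forall That : {a : grid n1 n2 | a \in Omega} -> R,
    (forall a, That a <> 0%R) ->
    forall T T' : 'M[R]_(n1, n2),
      rank_one T -> completes That T ->
      rank_one T' -> completes That T' -> T = T'.

Definition bip_adj (n1 n2 : nat) (Omega : {set grid n1 n2}) :
    rel ('I_n1 + 'I_n2) :=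
  fun x y =>
    match x, y with
    | inl i, inr j | inr j, inl i => (i, j) \in Omega
    | _, _ => false
    end.

(* The vertex set is nonempty in all uses, since n1, n2 > 0. *)
Definition connected_graph (V : finType) (e : rel V) : Prop :=
  forall x y : V, connect e x y.

(* Main.v *)
Require Import Defs.
From mathcomp Require Import all_boot all_order all_algebra.
From mathcomp Require Import reals.
From mathcomp Require Import zify.

(** Every one of the five properties is compared with connectedness of the
    bipartite graph whose edges are the cells of [Omega].

    To deduce connectedness, fix a vertex [x] and colour each vertex by whether
    it lies in the component of [x].  The two ends of a cell of [Omega] have
    equal colours, and each property spreads this to every cell of the grid.
    - For GS-propagation, the sum of the two colours of a cell, taken in F_2, is
      a linear functional of its indicator vector; when it vanishes at three
      cells of a generalized square, it vanishes at the fourth.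
    - In a strongly connected sequence, each cell after the first shares a
      vertex with an earlier one, so all cells have the same colour.
    - For unique recovery, doubling the row factors and halving the column
      factors inside the component of [x] leaves the all-ones matrix unchanged
      on [Omega], hence everywhere.
    So all rows and all columns have one colour, that of [x]
    ([connected_of_bicoloring]).

    Conversely, each property follows by walking along paths of the graph.
    - A path from row [i] to column [j] gives SR-propagation: crossing the row
      [i'] from a column [j1] to a column [j2] means that [(i', j1)] and
      [(i', j2)] are in [Omega], and the square on rows [i], [i'] moves the cell
      [(i, j1)] to [(i, j2)].
    - Appending the edges of a path to a strongly connected sequence keeps it
      strongly connected, and lets it reach any vertex.
    - If two rank-one matrices [u v] and [u' v'] agree on [Omega], the function
      that is [u / u'] on rows and [v' / v] on columns is constant along edges,
      hence constant, which says that the matrices agree everywhere.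

    The cycle is closed by the inclusions of the SR-closure in the S-closure and
    of the S-closure in the GS-closure: a square is a generalized square, because
    its diagonals have the same indices, up to order, in each coordinate. *)

Set Implicit Arguments.
Unset Strict Implicit.
Unset Printing Implicit Defensive.

Import GRing.Theory Num.Theory.

(** * Connectedness of the bipartite graph *)

(** [connect] is computed by a boolean search; this gives induction along paths
    for arbitrary propositions. *)
Lemma connect_ind (V : finType) (e : rel V) (P : V -> Prop) x y :
  (forall z t, P z -> e z t -> P t) -> P x -> connect e x y -> P y.
Proof.
move=> Pe Px /connectP [p ep ->].
elim: p x Px ep => //= z p IH x Px /andP [exz ep].
exact: IH (Pe _ _ Px exz) ep.
Qed.

Section Graph.
Variables (n1 n2 : nat) (Omega : {set grid n1 n2}).
Local Notation adj := (bip_adj Omega).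

Lemma bip_connect_sym : connect_sym adj.
Proof. by apply: sym_connect_sym; case=> [i|j] [i'|j']. Qed.

Lemma connect_cell x (a : grid n1 n2) :
  a \in Omega -> connect adj x (inl a.1) = connect adj x (inr a.2).
Proof.
case: a => i j /= aO.
by apply/(same_connect_r bip_connect_sym)/connect1.
Qed.

(** Taking [x] to be a row, every column has its colour, and then every row;
    symmetrically for a column. *)
Lemma connected_of_bicoloring :
  (0 < n1)%N -> (0 < n2)%N ->
  (forall x i j, connect adj x (inl i) = connect adj x (inr j)) ->
  connected_graph adj.
Proof.
move=> n1_gt0 n2_gt0 col.
pose i0 := Ordinal n1_gt0; pose j0 := Ordinal n2_gt0.
case=> [i|j].
  have rowi j : connect adj (inl i) (inr j) by rewrite -(col _ i).
  by case=> [i'|//]; rewrite (col _ i' j0).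
have colj i : connect adj (inr j) (inl i) by rewrite (col _ i j).
by case=> [//|j']; rewrite -(col _ i0 j').
Qed.

Definition touches (a : grid n1 n2) (x : 'I_n1 + 'I_n2) : Prop :=
  x = inl a.1 \/ x = inr a.2.

Lemma adj_cell x y : adj x y ->
  exists a, [/\ a \in Omega, touches a x & touches a y].
Proof.
case: x y => [i|j] [i'|j'] //= aO.
  by exists (i, j'); split=> //; [left | right].
by exists (i', j); split=> //; [right | left].
Qed.

Lemma touches_shares_index a b x :
  touches a x -> touches b x -> shares_index a b.
Proof. by case=> -> [] // [E]; [left | right]. Qed.

Lemma connected_touched : (0 < n1)%N -> (0 < n2)%N -> connected_graph adj ->
  forall x, exists2 a, a \in Omega & touches a x.
Proof.
move=> n1_gt0 n2_gt0 con x.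
have [y neq_xy]: exists y, x != y.
  case: x => [i|j]; first by exists (inr (Ordinal n2_gt0)).
  by exists (inl (Ordinal n1_gt0)).
case/connectP: (con x y) => [[|z p] /= ep Ey].
  by rewrite Ey eqxx in neq_xy.
case/andP: ep => /adj_cell [a [aO ax _]] _.
by exists a.
Qed.

(** * Strongly connected sequences *)

(** The same notion as [strongly_connected], on lists, which can be extended;
    the default cell [a0] of [nth] is never reached. *)
Definition chain (a0 : grid n1 n2) (s : seq (grid n1 n2)) : Prop :=
  {subset s <= Omega} /\
  forall k, (0 < k < size s)%N ->
    exists2 i, (i < k)%N & shares_index (nth a0 s k) (nth a0 s i).

Lemma chain_rcons a0 s a b :
  chain a0 s -> a \in s -> b \in Omega -> shares_index b a ->
  chain a0 (rcons s b).
Proof.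
move=> [sO sS] as_ bO ba; split=> [c|k].
  by rewrite mem_rcons in_cons => /orP [/eqP -> //|/sO].
rewrite size_rcons ltnS => /andP [k_gt0].
rewrite leq_eqVlt => /orP [/eqP Ek|k_lt].
  exists (index a s); first by rewrite Ek index_mem.
  by rewrite !nth_rcons index_mem as_ nth_index // Ek ltnn eqxx.
case: (sS k); first by rewrite k_gt0.
move=> i i_lt sh; exists i => //.
by rewrite !nth_rcons k_lt (ltn_trans i_lt k_lt).
Qed.

Definition covers (s : seq (grid n1 n2)) x : Prop :=
  exists2 a, a \in s & touches a x.

Lemma chain_connect a0 s x y :
  chain a0 s -> covers s x -> connect adj x y ->
  exists t, [/\ chain a0 t, {subset s <= t} & covers t y].
Proof.
move=> cs sx xy.
pose P z := exists t, [/\ chain a0 t, {subset s <= t} & covers t z].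
apply: (connect_ind (P := P) _ _ xy); last by exists s; split.
move=> z w [t [ct st [a at_ az]]] /adj_cell [b [bO bz bw]].
exists (rcons t b); split.
- exact: chain_rcons ct at_ bO (touches_shares_index bz az).
- by move=> c /st ct'; rewrite mem_rcons in_cons ct' orbT.
- by exists b => //; rewrite mem_rcons mem_head.
Qed.

Lemma chain_covering a0 : connected_graph adj -> a0 \in Omega ->
  forall xs : seq ('I_n1 + 'I_n2),
  exists s, [/\ chain a0 s, a0 \in s & forall x, x \in xs -> covers s x].
Proof.
move=> con a0O; elim=> [|y xs [s [cs a0s sxs]]].
  exists [:: a0]; split=> //; last by rewrite mem_head.
  by split=> [c|[|k]] //; rewrite inE => /eqP ->.
have s0: covers s (inl a0.1) by exists a0 => //; left.
have [t [ct st ty]] := chain_connect cs s0 (con _ y).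
exists t; split=> //; first exact: st.
move=> x; rewrite in_cons => /orP [/eqP -> //|/sxs [a as_ ax]].
by exists a => //; apply: st.
Qed.

Lemma connected_A : (0 < n1)%N -> (0 < n2)%N ->
  connected_graph adj -> A_propagation Omega.
Proof.
move=> n1_gt0 n2_gt0 con.
have [a0 a0O _] := connected_touched n1_gt0 n2_gt0 con (inl (Ordinal n1_gt0)).
have [s [[sO sS] _ cov]] := chain_covering con a0O (enum {: 'I_n1 + 'I_n2}).
exists (size s), (fun k => nth a0 s k); split.
- by move=> k; apply/sO/mem_nth.
- move=> k k_gt0; case: (sS k) => [|i i_lt sh]; first by rewrite k_gt0 ltn_ord.
  by exists (Ordinal (ltn_trans i_lt (ltn_ord k))).
- apply/setP=> i; rewrite inE; apply/bigcupP.
  case: (cov (inl i)) => [|a as_ [[Ei]|//]]; first by rewrite mem_enum.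
  have k_lt: (index a s < size s)%N by rewrite index_mem.
  by exists (Ordinal k_lt) => //=; rewrite nth_index // Ei set11.
- apply/setP=> j; rewrite inE; apply/bigcupP.
  case: (cov (inr j)) => [|a as_ [//|[Ej]]]; first by rewrite mem_enum.
  have k_lt: (index a s < size s)%N by rewrite index_mem.
  by exists (Ordinal k_lt) => //=; rewrite nth_index // Ej set11.
Qed.

Lemma A_connected : (0 < n1)%N -> (0 < n2)%N ->
  A_propagation Omega -> connected_graph adj.
Proof.
move=> n1_gt0 n2_gt0 [p [s [sO sS cov1 cov2]]].
apply: connected_of_bicoloring => // x i j.
have /bigcupP [k _ /set1P ->]: i \in \bigcup_(k < p) [set (s k).1].
  by rewrite cov1.
have /bigcupP [l _ /set1P ->]: j \in \bigcup_(k < p) [set (s k).2].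
  by rewrite cov2.
have p_gt0: (0 < p)%N by apply: leq_ltn_trans (ltn_ord k).
pose col h := connect adj x (inl (s h).1).
suff col0 m (h : 'I_p) : nat_of_ord h = m -> col h = col (Ordinal p_gt0).
  by rewrite -[LHS]/(col k) -(connect_cell _ (sO l)) -/(col l) !(col0 _ _ erefl).
elim/ltn_ind: m h => m IH h Eh.
have [h0|h_gt0] := posnP h; first by congr col; apply: val_inj.
have [g [g_lt sh]] := sS h h_gt0.
rewrite -(IH g _ g) -?Eh // /col.
by case: sh => E; [rewrite E | rewrite !(connect_cell _ (sO _)) E].
Qed.

(** * Propagation by squares *)

(** The invariant along a path starting at row [i]: a column [j] is reached
    only when [(i, j)] has been recovered, and a row [i'] only when [(i, j)] has
    been recovered for all columns [j] adjacent to it. *)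
Lemma connected_SR : connected_graph adj -> SR_propagation Omega.
Proof.
move=> con [i j].
pose P x := match x with
  | inr k => SR_closure Omega (i, k)
  | inl i' => forall k, (i', k) \in Omega -> SR_closure Omega (i, k) end.
apply: (connect_ind (P := P) _ _ (con (inl i) (inr j))); last first.
  by move=> k kO; apply: SR_base.
case=> [i'|k] [i''|k'] //=; first by move=> IH; apply: IH.
move=> Pk kO k' kO'.
have [Ei|neq_i] := eqVneq i'' i; first by rewrite -Ei; apply: SR_base.
have [<- //|neq_k] := eqVneq k k'.
apply: (SR_step kO' kO Pk); split=> //=; try by rewrite maxnC || rewrite minnC.
rewrite /= !inE !xpair_eqE !eqxx (negPf neq_i) (eq_sym i) (negPf neq_i).
by rewrite (eq_sym k') (negPf neq_k).
Qed.

Lemma SR_S : SR_propagation Omega -> S_propagation Omega.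
Proof.
move=> SR a; elim: (SR a) => [b bO|a1 a2 b c a1O a2O _ Sb sq].
  exact: S_base.
exact: S_step (S_base a1O) Sb (S_base a2O) sq.
Qed.

End Graph.

Lemma max_min_eq m (i i' k k' : 'I_m) :
  maxn i i' = maxn k k' -> minn i i' = minn k k' ->
  i = k /\ i' = k' \/ i = k' /\ i' = k.
Proof.
move=> Emax Emin.
have: (i = k :> nat /\ i' = k' :> nat) \/ (i = k' :> nat /\ i' = k :> nat) by lia.
by case=> [] [E E']; [left | right]; split; apply: val_inj.
Qed.

Local Open Scope ring_scope.

Lemma F2_mx_addxx m n (A : 'M['F_2]_(m, n)) : A + A = 0.
Proof. by apply/matrixP=> i j; rewrite !mxE addrr_pchar2 ?pchar_Fp. Qed.

Lemma square_generalized n1 n2 (a1 a2 a3 a4 : grid n1 n2) :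
  square a1 a2 a3 a4 -> generalized_square a1 a2 a3 a4.
Proof.
case=> Ua M1 m1 M2 m2; split=> //.
have diag m (i i' k k' : 'I_m) : maxn i i' = maxn k k' -> minn i i' = minn k k' ->
    delta_mx 0 i + delta_mx 0 i' + delta_mx 0 k + delta_mx 0 k'
      = 0 :> 'rV['F_2]_m.
  move=> M mm; rewrite -addrA.
  case: (max_min_eq M mm) => [] [-> ->]; first exact: F2_mx_addxx.
  by rewrite [X in _ + X]addrC F2_mx_addxx.
by rewrite /indicator !add_row_mx !diag // row_mx0.
Qed.

(** Over F_2, a colouring of rows and columns is a linear functional on the
    space of the indicator vectors. *)
Lemma generalized_square_coloring n1 n2 (f : 'I_n1 -> 'F_2) (g : 'I_n2 -> 'F_2)
    (a1 a2 a3 a4 : grid n1 n2) : generalized_square a1 a2 a3 a4 ->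
  (f a1.1 + g a1.2) + (f a2.1 + g a2.2) + (f a3.1 + g a3.2) + (f a4.1 + g a4.2)
    = 0.
Proof.
case=> _ sum0.
pose w : 'cV['F_2]_(n1 + n2) := col_mx (\col_i f i) (\col_j g j).
have val_w (a : grid n1 n2) : (indicator a *m w) 0 0 = f a.1 + g a.2.
  by rewrite mul_row_col -!rowE !mxE.
rewrite -!val_w; move: (congr1 (fun v => (v *m w) 0 0) sum0).
by rewrite !mulmxDl mul0mx !mxE.
Qed.

Section Recovery.
Variables (n1 n2 : nat) (Omega : {set grid n1 n2}).
Local Notation adj := (bip_adj Omega).

Lemma S_GS : S_propagation Omega -> GS_propagation Omega.
Proof.
move=> S a; elim: (S a) => [b bO|a1 a2 a3 b _ G1 _ G2 _ G3 sq].
  exact: GS_base.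
exact: GS_step G1 G2 G3 (square_generalized sq).
Qed.

Lemma GS_connected : (0 < n1)%N -> (0 < n2)%N ->
  GS_propagation Omega -> connected_graph adj.
Proof.
move=> n1_gt0 n2_gt0 GS; apply: connected_of_bicoloring => // x i j.
pose col z : 'F_2 := (connect adj x z)%:R.
have col_sum a : col (inl a.1) + col (inr a.2) = 0.
  elim: (GS a) => [b bO|a1 a2 a3 b _ E1 _ E2 _ E3 gs].
    by rewrite /col (connect_cell _ bO) addrr_pchar2 ?pchar_Fp.
  move: (generalized_square_coloring (col \o inl) (col \o inr) gs) => /=.
  by rewrite E1 E2 E3 !add0r.
by move: (col_sum (i, j)); rewrite /col /=; do 2!case: (connect adj x _).
Qed.

(** * Unique recovery *)

Variable R : realType.

Lemma rank_one_neq0 (u : 'rV[R]_n1) (v : 'rV[R]_n2) (i : 'I_n1) (j : 'I_n2) :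
  u 0 i * v 0 j != 0 -> rank_one (\matrix_(i, j) (u 0 i * v 0 j)).
Proof.
move=> /eqP uv; split; last by exists u, v => k l; rewrite mxE.
by move=> /matrixP /(_ i j); rewrite !mxE.
Qed.

Lemma unique_recovery_connected : (0 < n1)%N -> (0 < n2)%N ->
  unique_recovery R Omega -> connected_graph adj.
Proof.
move=> n1_gt0 n2_gt0 UR; apply: connected_of_bicoloring => // x i j.
pose c z : R := if connect adj x z then 2 else 1.
have c_neq0 z : c z != 0 by rewrite /c; case: ifP; rewrite (pnatr_eq0, oner_eq0).
pose u : 'rV[R]_n1 := \row_k c (inl k).
pose v : 'rV[R]_n2 := \row_k (c (inr k))^-1.
pose one1 : 'rV[R]_n1 := const_mx 1; pose one2 : 'rV[R]_n2 := const_mx 1.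
have /matrixP /(_ i j): \matrix_(k, l) (one1 0 k * one2 0 l)
    = \matrix_(k, l) (u 0 k * v 0 l).
  apply: (UR (fun=> 1)) => [a||||].
  - exact/eqP/oner_neq0.
  - by apply: (@rank_one_neq0 _ _ i j); rewrite !mxE mulr1 oner_neq0.
  - by move=> a; rewrite !mxE mulr1.
  - by apply: (@rank_one_neq0 _ _ i j); rewrite !mxE mulf_neq0 ?invr_neq0.
  - by move=> [a aO]; rewrite !mxE /c (connect_cell x aO) divff // -/(c _).
rewrite !mxE mulr1 => E.
have {E}: c (inl i) = c (inr j).
  by rewrite -[LHS](divfK (c_neq0 (inr j))) -E mul1r.
have neq12: (1 : R) <> 2 by move/eqP; rewrite (eqr_nat R 1 2).
by rewrite /c; do 2!case: (connect adj x _) => // /esym.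
Qed.

Lemma connected_unique_recovery : (0 < n1)%N -> (0 < n2)%N ->
  connected_graph adj -> unique_recovery R Omega.
Proof.
move=> n1_gt0 n2_gt0 con That That_neq0 T T' [_ [u [v Tuv]]] cT
  [_ [u' [v' Tuv']]] cT'.
have cell (a : grid n1 n2) : a \in Omega ->
    [/\ u 0 a.1 * v 0 a.2 != 0, u' 0 a.1 * v' 0 a.2 != 0
      & u 0 a.1 * v 0 a.2 = u' 0 a.1 * v' 0 a.2].
  move=> aO; rewrite -Tuv -Tuv' (cT (exist _ a aO)) (cT' (exist _ a aO)).
  by split=> //; apply/eqP/That_neq0.
(* Every row and column meets Omega, so no factor vanishes. *)
have row_neq0 i : u 0 i != 0 /\ u' 0 i != 0.
  have [a aO [[->]|//]] := connected_touched n1_gt0 n2_gt0 con (inl i).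
  by case: (cell a aO); rewrite !mulf_eq0 !negb_or => /andP [-> _] /andP [-> _].
have col_neq0 j : v 0 j != 0 /\ v' 0 j != 0.
  have [a aO [//|[->]]] := connected_touched n1_gt0 n2_gt0 con (inr j).
  by case: (cell a aO); rewrite !mulf_eq0 !negb_or => /andP [_ ->] /andP [_ ->].
pose g x := match x with inl i => u 0 i / u' 0 i | inr j => v' 0 j / v 0 j end.
have g_eq i j : g (inl i) = g (inr j) <-> u 0 i * v 0 j = u' 0 i * v' 0 j.
  have [_ u'0] := row_neq0 i; have [v0 _] := col_neq0 j.
  rewrite /= [in X in _ <-> X](mulrC (u' 0 i)); split.
    by move/eqP; rewrite eqr_div // => /eqP.
  by move=> E; apply/eqP; rewrite eqr_div //; apply/eqP.
apply/matrixP=> i j; rewrite Tuv Tuv'; apply/g_eq/esym.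
apply: (connect_ind (P := fun x => g x = g (inl i)) _ _ (con (inl i) _)) => //.
move=> x y <-; case: x y => [k|l] [k'|l'] //= /cell [_ _ /g_eq] //.
Qed.

End Recovery.

Theorem proposition2 (R : realType) (n1 n2 : nat)
    (hn1 : (0 < n1)%N) (hn2 : (0 < n2)%N) (Omega : {set grid n1 n2}) :
  ((A_propagation Omega <-> SR_propagation Omega) /\
   (SR_propagation Omega <-> S_propagation Omega) /\
   (S_propagation Omega <-> GS_propagation Omega) /\
   (GS_propagation Omega <-> unique_recovery R Omega)) /\
  (unique_recovery R Omega <-> connected_graph (bip_adj Omega)).
Proof.
have CA := @connected_A _ _ Omega hn1 hn2.
have AC := @A_connected _ _ Omega hn1 hn2.
have CSR := @connected_SR _ _ Omega.
have SRS := @SR_S _ _ Omega.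
have SGS := @S_GS _ _ Omega.
have GSC := @GS_connected _ _ Omega hn1 hn2.
have URC := @unique_recovery_connected _ _ Omega R hn1 hn2.
have CUR := @connected_unique_recovery _ _ Omega R hn1 hn2.
by tauto.
Qed.
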